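(* Let $H$ be a Hopf algebra with bijective antipode and $A$ a right $H$-comodule Poisson 3-Lie algebra. Assume that there exists an $H$-colinear map $\phi:H\to A^A$ such that $\phi(1_H)=1_A$. (1) If $H$ is commutative or $\phi$ is an algebra map, then every Poisson 3-Lie $(A,H)$-Hopf module which is injective as a 3-Lie $A$-module is an injective $(\underline{A},H)$-comodule. (2) If $H$ is commutative, then every Poisson 3-Lie $(A,H)$-Hopf module which is injective as a Poisson 3-Lie $A$-module is an injective Poisson 3-Lie $(A,H)$-Hopf module.
   Context: Everything is over a fixed field $k$ of characteristic 0; algebras are associative and unital and algebra maps are unital. $H$ is a Hopf algebra with $\Delta(h)=h_1\otimes h_2$; right $H$-coactions are written $\rho(m)=m_{(0)}\otimes m_{(1)}$. $H$ is a right $H$-comodule via $\Delta$. A 3-Lie algebra is a vector space $A$ with a skew-symmetric trilinear bracket $\{-,-,-\}:A^{\otimes 3}\to A$ satisfying $\{\{x,y,z\},u,v\}=\{\{x,u,v\},y,z\}+\{\{y,u,v\},z,x\}+\{\{z,u,v\},x,y\}$. A 3-Lie $A$-module is a vector space $M$ with a trilinear map $A\times A\times M\to M$, $(x,y,m)\mapsto (x,y)\diamond m$, such that $(x,y)\diamond m=-(y,x)\diamond m$; $(x,y)\diamond((u,v)\diamond m)-(u,v)\diamond((x,y)\diamond m)=(\{x,y,u\},v)\diamond m+(u,\{x,y,v\})\diamond m$; $(\{x,y,u\},v)\diamond m=(y,u)\diamond((x,v)\diamond m)-(x,u)\diamond((y,v)\diamond m)+(x,y)\diamond((u,v)\diamond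 m)$. A linear map $f$ between 3-Lie $A$-modules is 3-Lie $A$-linear if $f((x,y)\diamond m)=(x,y)\diamond f(m)$. A Poisson 3-Lie algebra is a commutative associative algebra $A$ with a 3-Lie bracket such that $\{x,y,uv\}=u\{x,y,v\}+\{x,y,u\}v$. A Poisson 3-Lie $A$-module is an $A$-module $(M,\cdot)$ which is also a 3-Lie $A$-module $(M,\diamond)$ with $(xy,z)\diamond m=x\cdot((y,z)\diamond m)+y\cdot((x,z)\diamond m)$ and $(x,y)\diamond(z\cdot m)=\{x,y,z\}\cdot m+z\cdot((x,y)\diamond m)$; morphisms are $A$-linear and 3-Lie $A$-linear maps. A right $H$-comodule Poisson 3-Lie algebra is a Poisson 3-Lie algebra $A$ that is a right $H$-comodule algebra with $\rho(\{x,y,z\})=\{x_{(0)},y_{(0)},z_{(0)}\}\otimes x_{(1)}y_{(1)}z_{(1)}$. Its center $A^A=\{b\in A:\{b,A,A\}=0\}$ is a subalgebra and $H$-subcomodule of $A$. An $(\underline{A},H)$-comodule is a 3-Lie $A$-module $M$ that is a right $H$-comodule with $\rho((x,y)\diamond m)=(x_{(0)},y_{(0)})\diamond m_{(0)}\otimes x_{(1)}y_{(1)}m_{(1)}$; morphisms are 3-Lie $A$-linear $H$-colinear maps. A Poisson 3-Lie $(A,H)$-Hopf module is a Poisson 3-Lie $A$-module $M$ that is an $(A,H)$-Hopf module (a left $A$-module and right $H$-comodule with $\rho(a\cdot m)=a_{(0)}\cdot m_{(0)}\otimes a_{(1)}m_{(1)}$) and an $(\underline{A},H)$-comodule; morphisms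 are $A$-linear, 3-Lie $A$-linear, $H$-colinear maps. ''Injective'' 3-Lie $A$-module, $(\underline{A},H)$-comodule, Poisson 3-Lie $A$-module, Poisson 3-Lie $(A,H)$-Hopf module means injective object in the respective category: every morphism from $U$ to it extends along every injective morphism $U\to V$. *)

(* Defs.v *)
From HB Require Import structures.
From mathcomp Require Import all_boot all_order all_algebra.
From mathcomp Require Import boolp.

Set Implicit Arguments.
Unset Strict Implicit.
Unset Printing Implicit Defensive.

Import GRing.Theory.
Local Open Scope ring_scope.
Local Open Scope quotient_scope.

Reserved Notation "U ⊗ V" (at level 40, left associativity).
Reserved Notation "u ⊗ₜ v" (at level 40, left associativity).

Section Multilinear.
Variables (k : fieldType) (U V W X : lmodType k).

Definition bilinear_map (f : U -> V -> W) : Prop :=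
  (forall v, linear (f^~ v)) /\ (forall u, linear (f u)).

Definition trilinear_map (f : U -> V -> W -> X) : Prop :=
  [/\ forall v w, linear (fun u => f u v w),
      forall u w, linear (fun v => f u v w)
    & forall u v, linear (fun w => f u v w)].
End Multilinear.

(* The tensor product over k. An element is a class of formal sums
   [:: (u_1, v_1); ...; (u_n, v_n)]; two formal sums are identified when no
   bilinear map distinguishes them. tens_lift_uniq below is the universal
   property. *)
Section Tensor.
Variables (k : fieldType) (U V : lmodType k).
Implicit Types (s t r : seq (U * V)) (W : lmodType k).

Definition tens_rel_prop s t : Prop :=
  forall W (f : U -> V -> W), bilinear_map f ->
    \sum_(p <- s) f p.1 p.2 = \sum_(p <- t) f p.1 p.2.

Definition tens_rel s t : bool := `[< tens_rel_prop s t >].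

Lemma tens_rel_refl : reflexive tens_rel.
Proof. by move=> s; apply/asboolP. Qed.

Lemma tens_rel_sym : symmetric tens_rel.
Proof. by move=> s t; apply/asboolP/asboolP => st W f fB; rewrite st. Qed.

Lemma tens_rel_trans : transitive tens_rel.
Proof.
by move=> t s r /asboolP st /asboolP tr; apply/asboolP=> W f fB; rewrite st ?tr.
Qed.

Canonical tens_equiv := EquivRel tens_rel tens_rel_refl tens_rel_sym tens_rel_trans.

Definition tensor := {eq_quot tens_equiv}.

HB.instance Definition _ := Choice.on tensor.
HB.instance Definition _ := EqQuotient.on tensor.

(* Sweedler notation: sw t is a chosen formal sum representing t, so that
   t = \sum_(p <- sw t) p.1 ⊗ₜ p.2 (lemma tens_sw). By sw_tens, sw_linear and
   sw_pi, \sum_(p <- sw t) f p.1 p.2 does not depend on the choice when f is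
   bilinear. *)
Definition sw (t : tensor) : seq (U * V) := repr t.

Definition tens (u : U) (v : V) : tensor := \pi_tensor [:: (u, v)].

Lemma sw_pi W (f : U -> V -> W) s : bilinear_map f ->
  \sum_(p <- sw (\pi_tensor s)) f p.1 p.2 = \sum_(p <- s) f p.1 p.2.
Proof.
move=> fB; have /eqmodP/asboolP : repr (\pi_tensor s) = s %[mod tensor].
  by rewrite reprK.
exact.
Qed.

Lemma tensorP (x y : tensor) :
  (forall W (f : U -> V -> W), bilinear_map f ->
     \sum_(p <- sw x) f p.1 p.2 = \sum_(p <- sw y) f p.1 p.2) -> x = y.
Proof.
by move=> xy; rewrite -[x]reprK -[y]reprK; apply/eqmodP/asboolP.
Qed.

Definition tens_add (x y : tensor) : tensor := \pi_tensor (sw x ++ sw y).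
Definition tens_scale (a : k) (x : tensor) : tensor :=
  \pi_tensor [seq (a *: p.1, p.2) | p <- sw x].
Definition tens_opp (x : tensor) : tensor := tens_scale (-1) x.
Definition tens0 : tensor := \pi_tensor [::].

Section Sums.
Variables (W : lmodType k) (f : U -> V -> W) (fB : bilinear_map f).

Lemma sw_add x y : \sum_(p <- sw (tens_add x y)) f p.1 p.2 =
  \sum_(p <- sw x) f p.1 p.2 + \sum_(p <- sw y) f p.1 p.2.
Proof. by rewrite sw_pi// big_cat. Qed.

Lemma sw_scale a x : \sum_(p <- sw (tens_scale a x)) f p.1 p.2 =
  a *: \sum_(p <- sw x) f p.1 p.2.
Proof.
rewrite sw_pi// big_map scaler_sumr; apply: eq_bigr => p _ /=.
exact: (scalable_linear (fB.1 p.2)).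
Qed.

Lemma sw_zero : \sum_(p <- sw tens0) f p.1 p.2 = 0.
Proof. by rewrite sw_pi// big_nil. Qed.
End Sums.

Lemma tens_addA : associative tens_add.
Proof. by move=> x y z; apply: tensorP => W f fB; rewrite !sw_add// addrA. Qed.
Lemma tens_addC : commutative tens_add.
Proof. by move=> x y; apply: tensorP => W f fB; rewrite !sw_add// addrC. Qed.
Lemma tens_add0 : left_id tens0 tens_add.
Proof. by move=> x; apply: tensorP => W f fB; rewrite !sw_add// sw_zero// add0r. Qed.
Lemma tens_addN : left_inverse tens0 tens_opp tens_add.
Proof.
move=> x; apply: tensorP => W f fB.
by rewrite !sw_add// sw_zero// sw_scale// scaleN1r addNr.
Qed.

HB.instance Definition _ :=
  GRing.isZmodule.Build tensor tens_addA tens_addC tens_add0 tens_addN.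

Lemma tens_scaleA a b x : tens_scale a (tens_scale b x) = tens_scale (a * b) x.
Proof. by apply: tensorP => W f fB; rewrite !sw_scale// scalerA. Qed.
Lemma tens_scale1 : left_id 1 tens_scale.
Proof. by move=> x; apply: tensorP => W f fB; rewrite !sw_scale// scale1r. Qed.
Lemma tens_scaleDr : right_distributive tens_scale +%R.
Proof.
move=> a x y; apply: tensorP => W f fB.
by rewrite (sw_scale fB) (sw_add fB) (sw_add fB) !sw_scale// scalerDr.
Qed.
Lemma tens_scaleDl x : {morph tens_scale^~ x : a b / a + b}.
Proof.
move=> a b; apply: tensorP => W f fB.
by rewrite (sw_scale fB) (sw_add fB) !sw_scale// scalerDl.
Qed.

HB.instance Definition _ := GRing.Zmodule_isLmodule.Build k tensor
  tens_scaleA tens_scale1 tens_scaleDr tens_scaleDl.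

Lemma sw_linear W (f : U -> V -> W) : bilinear_map f ->
  linear (fun t : tensor => \sum_(p <- sw t) f p.1 p.2).
Proof. by move=> fB a x y; rewrite (sw_add fB) (sw_scale fB). Qed.

Lemma sw_tens W (f : U -> V -> W) u v : bilinear_map f ->
  \sum_(p <- sw (tens u v)) f p.1 p.2 = f u v.
Proof. by move=> fB; rewrite sw_pi// big_seq1. Qed.

Lemma tens_bilinear : bilinear_map tens.
Proof.
split=> [v|u] a x y; apply: tensorP => W f fB;
  rewrite (sw_linear fB) !sw_tens//; [exact: fB.1|exact: fB.2].
Qed.

Lemma tens_sw (t : tensor) : \sum_(p <- sw t) tens p.1 p.2 = t.
Proof.
rewrite -[RHS]reprK -/(sw t); elim: (sw t) => [|[u v] s IHs].
  by rewrite big_nil.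
rewrite big_cons IHs; apply: tensorP => W f fB /=.
by rewrite (sw_add fB) sw_tens// !sw_pi// big_cons.
Qed.

Lemma tens_lift_uniq W (f : U -> V -> W) : bilinear_map f ->
  exists! g : tensor -> W, linear g /\ forall u v, g (tens u v) = f u v.
Proof.
move=> fB; exists (fun x => \sum_(p <- sw x) f p.1 p.2); split.
  by split=> [|u v]; [exact: sw_linear|exact: sw_tens].
move=> g [gL gE]; apply/funext => x.
have gD : {morph g : y z / y + z}.
  by move=> y z; have := gL 1 y z; rewrite !scale1r.
have g0 : g 0 = 0.
  by have := gL (-1) 0 0; rewrite !scaleN1r oppr0 addr0 => ->; rewrite addNr.
rewrite -[in RHS](tens_sw x) (big_morph g gD g0).
by apply: eq_bigr => p _; rewrite gE.
Qed.

End Tensor.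

Notation "U ⊗ V" := (tensor U V).
Notation "u ⊗ₜ v" := (tens u v).

(* Not a comAlgType, which would exclude the zero algebra. *)
Record comm_algebra (k : fieldType) (A : lmodType k) (mul : A -> A -> A)
    (one : A) : Prop := {
  comm_alg_bilinear : bilinear_map mul;
  comm_algA : associative mul;
  comm_algC : commutative mul;
  comm_alg1 : left_id one mul
}.

Section HopfAlgebra.
Variables (k : fieldType) (H : algType k).
Variables (D : {linear H -> H ⊗ H}) (eps : {linear H -> k^o}).

Record coalgebra : Prop := {
  coalg_coassoc : forall h,
    \sum_(p <- sw (D h)) \sum_(q <- sw (D p.1)) q.1 ⊗ₜ (q.2 ⊗ₜ p.2)
      = \sum_(p <- sw (D h)) p.1 ⊗ₜ D p.2;
  coalg_counitl : forall h, \sum_(p <- sw (D h)) eps p.1 *: p.2 = h;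
  coalg_counitr : forall h, \sum_(p <- sw (D h)) eps p.2 *: p.1 = h
}.

Record bialgebra : Prop := {
  bialg_coalg : coalgebra;
  comul1 : D 1 = 1 ⊗ₜ 1;
  comulM : forall g h, D (g * h) =
    \sum_(p <- sw (D g)) \sum_(q <- sw (D h)) (p.1 * q.1) ⊗ₜ (p.2 * q.2);
  counit_monoid_morphism : monoid_morphism eps
}.

Record hopf_algebra (S : {linear H -> H}) : Prop := {
  hopf_bialg : bialgebra;
  antipodel : forall h, \sum_(p <- sw (D h)) S p.1 * p.2 = (eps h)%:A;
  antipoder : forall h, \sum_(p <- sw (D h)) p.1 * S p.2 = (eps h)%:A
}.

Record comodule (M : lmodType k) (rho : {linear M -> M ⊗ H}) : Prop := {
  comod_coassoc : forall m,
    \sum_(p <- sw (rho m)) \sum_(q <- sw (rho p.1)) q.1 ⊗ₜ (q.2 ⊗ₜ p.2)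
      = \sum_(p <- sw (rho m)) p.1 ⊗ₜ D p.2;
  comod_counit : forall m, \sum_(p <- sw (rho m)) eps p.2 *: p.1 = m
}.

Record comodule_algebra (A : lmodType k) (mul : A -> A -> A) (one : A)
    (rho : {linear A -> A ⊗ H}) : Prop := {
  comod_alg_comod : comodule rho;
  coaction1 : rho one = one ⊗ₜ 1;
  coactionM : forall a b, rho (mul a b) =
    \sum_(p <- sw (rho a)) \sum_(q <- sw (rho b)) mul p.1 q.1 ⊗ₜ (p.2 * q.2)
}.
End HopfAlgebra.

Definition colinear (k : fieldType) (H : algType k) (M N : lmodType k)
    (rhoM : {linear M -> M ⊗ H}) (rhoN : {linear N -> N ⊗ H})
    (f : {linear M -> N}) : Prop :=
  forall m, rhoN (f m) = \sum_(p <- sw (rhoM m)) f p.1 ⊗ₜ p.2.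

Section Lie3.
Variables (k : fieldType).

Record lie3_algebra (A : lmodType k) (br : A -> A -> A -> A) : Prop := {
  lie3_trilinear : trilinear_map br;
  lie3_skew12 : forall x y z, br y x z = - br x y z;
  lie3_skew23 : forall x y z, br x z y = - br x y z;
  lie3_fundamental : forall x y z u v,
    br (br x y z) u v
      = br (br x u v) y z + br (br y u v) z x + br (br z u v) x y
}.

Definition lie3_center (A : lmodType k) (br : A -> A -> A -> A) (b : A) : Prop :=
  forall x y, br b x y = 0.

Record lie3_module (A : lmodType k) (br : A -> A -> A -> A)
    (M : lmodType k) (dia : A -> A -> M -> M) : Prop := {
  lie3_mod_trilinear : trilinear_map dia;
  lie3_mod_skew : forall x y m, dia x y m = - dia y x m;
  lie3_mod_comm : forall x y u v m,
    dia x y (dia u v m) - dia u v (dia x y m)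
      = dia (br x y u) v m + dia u (br x y v) m;
  lie3_mod_bracket : forall x y u v m,
    dia (br x y u) v m
      = dia y u (dia x v m) - dia x u (dia y v m) + dia x y (dia u v m)
}.

Definition lie3_linear (A M N : lmodType k)
    (diaM : A -> A -> M -> M) (diaN : A -> A -> N -> N) (f : {linear M -> N}) :
    Prop :=
  forall x y m, f (diaM x y m) = diaN x y (f m).

Definition injective_lie3_module (A : lmodType k) (br : A -> A -> A -> A)
    (M : lmodType k) (diaM : A -> A -> M -> M) : Prop :=
  forall (U V : lmodType k)
    (diaU : A -> A -> U -> U) (diaV : A -> A -> V -> V),
  lie3_module br diaU -> lie3_module br diaV ->
  forall (i : {linear U -> V}) (f : {linear U -> M}),
  lie3_linear diaU diaV i -> injective i -> lie3_linear diaU diaM f ->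
  exists g : {linear V -> M},
    lie3_linear diaV diaM g /\ forall u, g (i u) = f u.
End Lie3.

Section Poisson3.
Variables (k : fieldType) (A : lmodType k) (mul : A -> A -> A) (one : A).

Record poisson3_algebra (br : A -> A -> A -> A) : Prop := {
  poisson3_comm : comm_algebra mul one;
  poisson3_lie3 : lie3_algebra br;
  poisson3_leibniz : forall x y u v,
    br x y (mul u v) = mul u (br x y v) + mul (br x y u) v
}.

Record alg_module (M : lmodType k) (dot : A -> M -> M) : Prop := {
  alg_mod_bilinear : bilinear_map dot;
  alg_mod1 : forall m, dot one m = m;
  alg_modM : forall a b m, dot (mul a b) m = dot a (dot b m)
}.

Definition alg_map (H : algType k) (phi : {linear H -> A}) : Prop :=
  phi 1 = one /\ {morph phi : g h / g * h >-> mul g h}.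

Definition alg_linear (M N : lmodType k) (dotM : A -> M -> M)
    (dotN : A -> N -> N) (f : {linear M -> N}) : Prop :=
  forall a m, f (dotM a m) = dotN a (f m).

Record poisson3_module (br : A -> A -> A -> A) (M : lmodType k)
    (dot : A -> M -> M) (dia : A -> A -> M -> M) : Prop := {
  poisson3_mod_alg : alg_module dot;
  poisson3_mod_lie3 : lie3_module br dia;
  poisson3_modl : forall x y z m,
    dia (mul x y) z m = dot x (dia y z m) + dot y (dia x z m);
  poisson3_modr : forall x y z m,
    dia x y (dot z m) = dot (br x y z) m + dot z (dia x y m)
}.

Definition injective_poisson3_module (br : A -> A -> A -> A)
    (M : lmodType k) (dotM : A -> M -> M) (diaM : A -> A -> M -> M) : Prop :=
  forall (U V : lmodType k)
    (dotU : A -> U -> U) (diaU : A -> A -> U -> U)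
    (dotV : A -> V -> V) (diaV : A -> A -> V -> V),
  poisson3_module br dotU diaU -> poisson3_module br dotV diaV ->
  forall (i : {linear U -> V}) (f : {linear U -> M}),
  alg_linear dotU dotV i -> lie3_linear diaU diaV i -> injective i ->
  alg_linear dotU dotM f -> lie3_linear diaU diaM f ->
  exists g : {linear V -> M},
    [/\ alg_linear dotV dotM g, lie3_linear diaV diaM g
      & forall u, g (i u) = f u].
End Poisson3.

Section ComodulePoisson3.
Variables (k : fieldType) (H : algType k).
Variables (D : {linear H -> H ⊗ H}) (eps : {linear H -> k^o}).
Variables (A : lmodType k) (mul : A -> A -> A) (one : A).
Variable (br : A -> A -> A -> A).
Variable (rhoA : {linear A -> A ⊗ H}).

Record comodule_poisson3_algebra : Prop := {
  comod_poisson3 : poisson3_algebra mul one br;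
  comod_poisson3_alg : comodule_algebra D eps mul one rhoA;
  coaction_bracket : forall x y z, rhoA (br x y z) =
    \sum_(p <- sw (rhoA x)) \sum_(q <- sw (rhoA y)) \sum_(r <- sw (rhoA z))
      br p.1 q.1 r.1 ⊗ₜ (p.2 * q.2 * r.2)
}.

Record lie3_comodule (M : lmodType k) (dia : A -> A -> M -> M)
    (rho : {linear M -> M ⊗ H}) : Prop := {
  lie3_comod_lie3 : lie3_module br dia;
  lie3_comod_comod : comodule D eps rho;
  coaction_dia : forall x y m, rho (dia x y m) =
    \sum_(p <- sw (rhoA x)) \sum_(q <- sw (rhoA y)) \sum_(r <- sw (rho m))
      dia p.1 q.1 r.1 ⊗ₜ (p.2 * q.2 * r.2)
}.

Definition injective_lie3_comodule (M : lmodType k)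
    (diaM : A -> A -> M -> M) (rhoM : {linear M -> M ⊗ H}) : Prop :=
  forall (U V : lmodType k)
    (diaU : A -> A -> U -> U) (rhoU : {linear U -> U ⊗ H})
    (diaV : A -> A -> V -> V) (rhoV : {linear V -> V ⊗ H}),
  lie3_comodule diaU rhoU -> lie3_comodule diaV rhoV ->
  forall (i : {linear U -> V}) (f : {linear U -> M}),
  lie3_linear diaU diaV i -> colinear rhoU rhoV i -> injective i ->
  lie3_linear diaU diaM f -> colinear rhoU rhoM f ->
  exists g : {linear V -> M},
    [/\ lie3_linear diaV diaM g, colinear rhoV rhoM g
      & forall u, g (i u) = f u].

Record hopf_module (M : lmodType k) (dot : A -> M -> M)
    (rho : {linear M -> M ⊗ H}) : Prop := {
  hopf_mod_alg : alg_module mul one dot;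
  hopf_mod_comod : comodule D eps rho;
  coaction_dot : forall a m, rho (dot a m) =
    \sum_(p <- sw (rhoA a)) \sum_(q <- sw (rho m)) dot p.1 q.1 ⊗ₜ (p.2 * q.2)
}.

Record poisson3_hopf_module (M : lmodType k) (dot : A -> M -> M)
    (dia : A -> A -> M -> M) (rho : {linear M -> M ⊗ H}) : Prop := {
  poisson3_hopf_poisson3 : poisson3_module mul one br dot dia;
  poisson3_hopf_hopf : hopf_module dot rho;
  poisson3_hopf_lie3_comod : lie3_comodule dia rho
}.

Definition injective_poisson3_hopf_module (M : lmodType k)
    (dotM : A -> M -> M) (diaM : A -> A -> M -> M)
    (rhoM : {linear M -> M ⊗ H}) : Prop :=
  forall (U V : lmodType k)
    (dotU : A -> U -> U) (diaU : A -> A -> U -> U) (rhoU : {linear U -> U ⊗ H})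
    (dotV : A -> V -> V) (diaV : A -> A -> V -> V) (rhoV : {linear V -> V ⊗ H}),
  poisson3_hopf_module dotU diaU rhoU -> poisson3_hopf_module dotV diaV rhoV ->
  forall (i : {linear U -> V}) (f : {linear U -> M}),
  alg_linear dotU dotV i -> lie3_linear diaU diaV i -> colinear rhoU rhoV i ->
  injective i ->
  alg_linear dotU dotM f -> lie3_linear diaU diaM f -> colinear rhoU rhoM f ->
  exists g : {linear V -> M},
    [/\ alg_linear dotV dotM g, lie3_linear diaV diaM g, colinear rhoV rhoM g
      & forall u, g (i u) = f u].
End ComodulePoisson3.

(* Main.v *)
(** A lift [g0 : V -> M] provided by injectivity over [A] is turned into a
    colinear one by averaging: [g v = lam (g0 v_(0)) v_(1)], where
    [lam m h = phi (h * T m_(1)) . m_(0)] and [T] is the inverse of the antipode.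
    Since [lam (m_(0)) (h * m_(1)) = phi h . m] and the elements
    [m_(0) ⊗ h * m_(1)] span [M ⊗ H], the identities needed from [lam] (it is
    colinear and compatible with the actions of [A]) can be checked on these
    elements, where the antipode disappears. Compatibility with the actions uses
    [phi (g * h * t) = phi (h * g * t)], valid when [H] is commutative or [phi] is
    an algebra map, and the fact that [phi] takes values in the center. *)

Require Import Defs.
From HB Require Import structures.
From mathcomp Require Import all_boot all_order all_algebra.

Import GRing.Theory.
Local Open Scope ring_scope.

Set Implicit Arguments.
Unset Strict Implicit.
Unset Printing Implicit Defensive.

(** * Sweedler sums as maps induced on tensor products *)

(** For bilinear [f] this is the induced linear map on [U ⊗ V]; for other [f] it depends on the
    chosen formal sum. Rearranging sums ([eq_lift], [lift_exchange]) needs no bilinearity,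
    evaluation on pure tensors and nesting do. *)
Definition tens_lift (k : fieldType) (U V W : lmodType k) (f : U -> V -> W)
    (t : U ⊗ V) : W :=
  \sum_(p <- sw t) f p.1 p.2.

Notation "'\sw_' ( u , v <- t ) E" := (tens_lift (fun u v => E) t)
  (at level 41, E at level 41, u, v at level 10, t at level 50,
   format "'\sw_' ( u ,  v  <-  t )  E").

Section Lift.
Variable k : fieldType.

Lemma eq_lift (U V W : lmodType k) (f g : U -> V -> W) t :
  (forall u v, f u v = g u v) -> tens_lift f t = tens_lift g t.
Proof. by move=> fg; apply: eq_bigr. Qed.

Lemma lift_exchange (U V U' V' W : lmodType k) (f : U -> V -> U' -> V' -> W) s t :
  \sw_(u, v <- s) \sw_(u', v' <- t) f u v u' v'
    = \sw_(u', v' <- t) \sw_(u, v <- s) f u v u' v'.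
Proof. exact: exchange_big. Qed.

Lemma linear_lift (U V W X : lmodType k) (L : W -> X) (f : U -> V -> W) t :
  linear L -> L (tens_lift f t) = \sw_(u, v <- t) L (f u v).
Proof.
move=> lL; pose L' : {linear W -> X} := HB.pack L (GRing.isLinear.Build k W X *:%R L lL).
exact: (raddf_sum L').
Qed.

Lemma app_lift (U V W X : lmodType k) (L : {linear W -> X}) (f : U -> V -> W) t :
  L (tens_lift f t) = \sw_(u, v <- t) L (f u v).
Proof. exact: raddf_sum. Qed.

Lemma bil_lift1 (U V W W' X : lmodType k) (B : W -> W' -> X) (f : U -> V -> W) t w :
  bilinear_map B -> B (tens_lift f t) w = \sw_(u, v <- t) B (f u v) w.
Proof. by move=> bB; exact: (linear_lift f t (bB.1 w)). Qed.

Lemma bil_lift2 (U V W W' X : lmodType k) (B : W' -> W -> X) (f : U -> V -> W) t w :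
  bilinear_map B -> B w (tens_lift f t) = \sw_(u, v <- t) B w (f u v).
Proof. by move=> bB; exact: (linear_lift f t (bB.2 w)). Qed.

Lemma lift_tens (U V W : lmodType k) (f : U -> V -> W) u v :
  bilinear_map f -> tens_lift f (u ⊗ₜ v) = f u v.
Proof. exact: sw_tens. Qed.

Lemma linear_id (U : lmodType k) : linear (fun u : U => u).
Proof. by []. Qed.

Lemma linear_app (U V W : lmodType k) (f : {linear V -> W}) (g : U -> V) :
  linear g -> linear (fun u => f (g u)).
Proof. by move=> lg a x y; rewrite lg linearP. Qed.

Lemma linear_bil1 (U V W X : lmodType k) (B : V -> W -> X) (g : U -> V) w :
  bilinear_map B -> linear g -> linear (fun u => B (g u) w).
Proof. by move=> lB lg a x y; rewrite lg lB.1. Qed.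

Lemma linear_bil2 (U V W X : lmodType k) (B : W -> V -> X) (g : U -> V) w :
  bilinear_map B -> linear g -> linear (fun u => B w (g u)).
Proof. by move=> lB lg a x y; rewrite lg lB.2. Qed.

Lemma linear_lift_arg (U V W X : lmodType k) (f : V -> W -> X) (g : U -> V ⊗ W) :
  linear g -> bilinear_map f -> linear (fun u => tens_lift f (g u)).
Proof. by move=> lg lf a x y; rewrite lg /tens_lift (sw_linear lf). Qed.

Lemma linear_lift_body (U V W X : lmodType k) (f : U -> V -> W -> X) t :
  (forall v w, linear (fun u => f u v w)) ->
  linear (fun u => \sw_(v, w <- t) f u v w).
Proof.
move=> lf a x y; rewrite /tens_lift scaler_sumr -big_split /=.
by apply: eq_bigr => p _; rewrite lf.
Qed.

Lemma linear_tri1 (U V1 V2 V3 X : lmodType k) (B : V1 -> V2 -> V3 -> X)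
  (g : U -> V1) y z :
  trilinear_map B -> linear g -> linear (fun u => B (g u) y z).
Proof. by case=> lB _ _ lg a u v; rewrite lg lB. Qed.

Lemma linear_tri2 (U V1 V2 V3 X : lmodType k) (B : V1 -> V2 -> V3 -> X)
  (g : U -> V2) x z :
  trilinear_map B -> linear g -> linear (fun u => B x (g u) z).
Proof. by case=> _ lB _ lg a u v; rewrite lg lB. Qed.

Lemma linear_tri3 (U V1 V2 V3 X : lmodType k) (B : V1 -> V2 -> V3 -> X)
  (g : U -> V3) x y :
  trilinear_map B -> linear g -> linear (fun u => B x y (g u)).
Proof. by case=> _ _ lB lg a u v; rewrite lg lB. Qed.

Lemma mul_bilinear (H : algType k) : bilinear_map ( *%R : H -> H -> H).
Proof.
split=> [v|u] a x y; first by rewrite mulrDl scalerAl.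
by rewrite mulrDr scalerAr.
Qed.

Lemma scale_bilinear (U : lmodType k) :
  bilinear_map ( *:%R : k^o -> U -> U).
Proof.
split=> [v|u] a x y; first by rewrite scalerDl -scalerA.
by rewrite scalerDr !scalerA mulrC.
Qed.

(** Holds because the map induced by [G] is linear. With [lift_tens] it turns axioms stated as
    equations between tensors into sums of values of [G]. *)
Lemma lift_lift (U V U' V' W : lmodType k) (f : U -> V -> U' ⊗ V')
    (G : U' -> V' -> W) t : bilinear_map G ->
  tens_lift G (tens_lift f t) = \sw_(u, v <- t) tens_lift G (f u v).
Proof.
by move=> bG; exact: (linear_lift f t (sw_linear bG)).
Qed.

End Lift.


(** Proves linearity by recursion on the term: multilinear goals are split into one linear goal per
    variable, and each of these is peeled from the outermost operation inwards. *)
Ltac lin := lazymatch goal with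
  | |- bilinear_map _ => first
    [ assumption | exact: mul_bilinear | exact: scale_bilinear
    | exact: tens_bilinear | split => ? /=; lin ]
  | |- trilinear_map _ => first [ assumption | split => ? ? /=; lin ]
  | |- _ => first
    [ assumption
    | exact: linear_id
    | apply: linear_lift_arg; [lin | lin]
    | apply: linear_lift_body => ? ? /=; lin
    | apply: linear_bil1; [lin_op | lin]
    | apply: linear_bil2; [lin_op | lin]
    | apply: linear_tri1; [assumption | lin]
    | apply: linear_tri2; [assumption | lin]
    | apply: linear_tri3; [assumption | lin]
    | apply: linear_app; lin ]
  end
with lin_op := first
    [ assumption | exact: mul_bilinear | exact: scale_bilinear
    | exact: tens_bilinear ].

(** * Coassociativity, the antipode and its inverse *)

Section Hopf.
Variables (k : fieldType) (H : algType k).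
Variables (D : {linear H -> H ⊗ H}) (eps : {linear H -> k^o}).

(** Coassociativity tested against a trilinear [F]: the map that [F] induces on [M ⊗ (H ⊗ H)] is
    applied to both sides of the axiom. *)
Lemma comodule_lift (M W : lmodType k) (rho : {linear M -> M ⊗ H})
    (F : M -> H -> H -> W) m : comodule D eps rho -> trilinear_map F ->
  \sw_(n, t <- rho m) \sw_(n', t' <- rho n) F n' t' t
    = \sw_(n, t <- rho m) \sw_(t1, t2 <- D t) F n t1 t2.
Proof.
move=> cM tF; have [F1 F2 F3] := tF.
pose G n s := tens_lift (F n) s.
have bF n : bilinear_map (F n) by split=> ?; [exact: F2 | exact: F3].
have bG : bilinear_map G by rewrite /G; lin.
have /= := congr1 (tens_lift G) (comod_coassoc cM m).
(* The sums in the axiom are convertible to [tens_lift]; folding them makes the lemmas on lifts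
   applicable. *)
rewrite -/(\sw_(n, t <- rho m) \sw_(n', t' <- rho n) n' ⊗ₜ (t' ⊗ₜ t)).
rewrite -/(\sw_(n, t <- rho m) n ⊗ₜ D t) !lift_lift//.
under eq_lift => n t.
  rewrite lift_lift//; under eq_lift => n' t' do rewrite lift_tens// /G lift_tens//.
  over.
by move=> ->; apply: eq_lift => n t; rewrite lift_tens.
Qed.

Lemma counit_lift (M : lmodType k) (rho : {linear M -> M ⊗ H}) m :
  comodule D eps rho -> \sw_(n, t <- rho m) eps t *: n = m.
Proof. by move=> cM; apply: (comod_counit cM). Qed.

Lemma coalgebra_comodule : coalgebra D eps -> comodule D eps D.
Proof. by case=> cA _ cr; split. Qed.

Variable (S : {linear H -> H}).
Hypothesis HH : hopf_algebra D eps S.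

Let bialg := hopf_bialg HH.
Let DD : comodule D eps D := coalgebra_comodule (bialg_coalg bialg).

Lemma comulM_lift (W : lmodType k) (F : H -> H -> W) g h : bilinear_map F ->
  tens_lift F (D (g * h))
    = \sw_(g1, g2 <- D g) \sw_(h1, h2 <- D h) F (g1 * h1) (g2 * h2).
Proof.
move=> bF; rewrite (comulM bialg).
rewrite -/(\sw_(g1, g2 <- D g) \sw_(h1, h2 <- D h) (g1 * h1) ⊗ₜ (g2 * h2)).
rewrite lift_lift//; apply: eq_lift => g1 g2.
by rewrite lift_lift//; apply: eq_lift => h1 h2; rewrite lift_tens.
Qed.

Lemma counitl_lift h : \sw_(h1, h2 <- D h) eps h1 *: h2 = h.
Proof. exact: (coalg_counitl (bialg_coalg bialg)). Qed.

Lemma antipodel_lift h : \sw_(h1, h2 <- D h) S h1 * h2 = (eps h)%:A.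
Proof. exact: antipodel. Qed.

Lemma antipoder_lift h : \sw_(h1, h2 <- D h) h1 * S h2 = (eps h)%:A.
Proof. exact: antipoder. Qed.

Lemma mul_liftl (f : H -> H -> H) s h :
  tens_lift f s * h = \sw_(a, b <- s) f a b * h.
Proof. exact: mulr_suml. Qed.

Lemma mul_liftr (f : H -> H -> H) s h :
  h * tens_lift f s = \sw_(a, b <- s) h * f a b.
Proof. exact: mulr_sumr. Qed.

(* Both sides are convolution inverses of the multiplication [H ⊗ H -> H]. *)
Lemma antipodeM g h : S (g * h) = S h * S g.
Proof.
(* [S (x * y)] is a left convolution inverse of the product; [inr] below shows that [S y * S x] is a
   right one. *)
have inl x y : \sw_(x1, x2 <- D x) \sw_(y1, y2 <- D y)
    S (x1 * y1) * (x2 * y2) = eps y *: (eps x *: 1).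
  rewrite -(comulM_lift (F := fun a b => S a * b)); last by lin.
  by rewrite antipodel_lift (counit_monoid_morphism bialg).2 scalerA mulrC.
have inr x y : \sw_(x1, x2 <- D x) \sw_(y1, y2 <- D y)
    (x1 * y1) * (S y2 * S x2) = eps y *: (eps x *: 1).
  under eq_lift => x1 x2.
    under eq_lift => y1 y2 do rewrite -mulrA (mulrA y1).
    rewrite -mul_liftr -mul_liftl antipoder_lift mulr_algl -scalerAr.
    over.
  rewrite -(bil_lift2 _ _ _ (scale_bilinear H)).
  by rewrite antipoder_lift.
(* Summand of the triple convolution product of the left inverse, the product and the right inverse.
   Bracketed to the right it collapses by [inr] to [S (g * h)], bracketed to the left by [inl] to
   [S h * S g]. *)
pose F g1 g2 g3 h1 h2 h3 := S (g1 * h1) * (g2 * h2) * (S h3 * S g3).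
transitivity (\sw_(g1, x <- D g) \sw_(g2, g3 <- D x)
  \sw_(h1, y <- D h) \sw_(h2, h3 <- D y) F g1 g2 g3 h1 h2 h3).
  transitivity (\sw_(g1, x <- D g) \sw_(h1, y <- D h)
    S ((eps x *: g1) * (eps y *: h1))).
    under eq_lift => g1 x do rewrite -app_lift -mul_liftr counit_lift//.
    by rewrite -app_lift -mul_liftl counit_lift.
  apply: eq_lift => g1 x; rewrite lift_exchange; apply: eq_lift => h1 y.
  under [RHS]eq_lift => g2 g3.
    under eq_lift => h2 h3 do rewrite /F -mulrA.
    rewrite -mul_liftr.
    over.
  rewrite -mul_liftr inr -!scalerAr mulr1 -scalerAl !linearZ /=.
  by rewrite !scalerA mulrC.
(* The change of bracketing is coassociativity, once in [h] and once in [g]. *)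
transitivity (\sw_(x, g3 <- D g) \sw_(g1, g2 <- D x)
  \sw_(y, h3 <- D h) \sw_(h1, h2 <- D y) F g1 g2 g3 h1 h2 h3).
  under [RHS]eq_lift => x g3.
    under eq_lift => g1 g2.
      rewrite (comodule_lift (F := F g1 g2 g3)) //; last by rewrite /F; lin.
      over.
    over.
  rewrite (comodule_lift (F := fun g1 g2 g3 => \sw_(h1, y <- D h)
    \sw_(h2, h3 <- D y) F g1 g2 g3 h1 h2 h3))//.
  by rewrite /F; lin.
transitivity (\sw_(x, g3 <- D g) \sw_(y, h3 <- D h)
    S (eps y *: h3) * S (eps x *: g3)).
  apply: eq_lift => x g3; rewrite lift_exchange; apply: eq_lift => y h3.
  under eq_lift => g1 g2 do rewrite -mul_liftl.
  rewrite -mul_liftl inl -!scalerAl mul1r !linearZ /=.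
  by rewrite -scalerAl -scalerAr !scalerA mulrC.
under eq_lift => x g3 do rewrite -mul_liftl -app_lift counitl_lift.
by rewrite -mul_liftr -app_lift counitl_lift.
Qed.

Lemma antipode1 : S 1 = 1.
Proof.
have := antipodel_lift 1; rewrite (comul1 bialg) lift_tens; last by lin.
by rewrite mulr1 (counit_monoid_morphism bialg).1 scale1r.
Qed.

Variable (T : {linear H -> H}).
Hypotheses (ST : cancel S T) (TS : cancel T S).

(** Since [S] is injective and reverses products, applying it reduces the claim to the antipode
    axiom: [T] is an antipode for the opposite multiplication. *)
Lemma inv_antipodel_lift h : \sw_(h1, h2 <- D h) T h2 * h1 = (eps h)%:A.
Proof.
apply: (can_inj ST); rewrite app_lift linearZ /= antipode1 -antipodel_lift.
by apply: eq_lift => h1 h2; rewrite antipodeM TS.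
Qed.

Lemma inv_antipoder_lift h : \sw_(h1, h2 <- D h) h2 * T h1 = (eps h)%:A.
Proof.
apply: (can_inj ST); rewrite app_lift linearZ /= antipode1 -antipoder_lift.
by apply: eq_lift => h1 h2; rewrite antipodeM TS.
Qed.
End Hopf.

(** * The averaging operator on [M ⊗ H] *)

Section Averaging.
Variables (k : fieldType) (H : algType k).
Variables (D : {linear H -> H ⊗ H}) (eps : {linear H -> k^o}).
Variables (S : {linear H -> H}) (HH : hopf_algebra D eps S).
Variables (T : {linear H -> H}) (ST : cancel S T) (TS : cancel T S).
Variables (A : lmodType k) (mul : A -> A -> A) (one : A).
Variables (rhoA : {linear A -> A ⊗ H}) (phi : {linear H -> A}).
Hypothesis phi_colinear : colinear D rhoA phi.
Variables (M : lmodType k) (dot : A -> M -> M) (rho : {linear M -> M ⊗ H}).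
Hypothesis hM : hopf_module D eps mul one rhoA dot rho.

Let cM : comodule D eps rho := hopf_mod_comod hM.
Let bdot : bilinear_map dot := alg_mod_bilinear (hopf_mod_alg hM).

(* A colinear retraction of [rho], for the coaction [id ⊗ D] of [M ⊗ H]. *)
Definition average (m : M) (h : H) : M :=
  \sw_(n, t <- rho m) dot (phi (h * T t)) n.

Lemma average_bilinear : bilinear_map average.
Proof. by rewrite /average; lin. Qed.

Let bavg : bilinear_map average := average_bilinear.

(** Coassociativity brings the argument of [phi] to the form [h * t2 * T t1], with [t1], [t2] from
    [D t], and the inverse antipode cancels. For [h = 1] and [phi 1 = one] this is the retraction
    property. *)
Lemma average_coaction m h : \sw_(n, t <- rho m) average n (h * t) = dot (phi h) m.
Proof.
rewrite /average (comodule_lift (F := fun n' t' t => dot (phi (h * t * T t')) n')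
  m cM); last by lin.
transitivity (\sw_(n, t <- rho m) dot (phi h) (eps t *: n)).
  apply: eq_lift => n t.
  under eq_lift => t1 t2 do rewrite -mulrA.
  rewrite -(bil_lift1 (B := fun x y => dot (phi (h * x)) y)); last by lin.
  rewrite (inv_antipoder_lift HH ST TS) -scalerAr mulr1 linearZ /=.
  have l1 := bdot.1 n; have l2 := bdot.2 (phi h).
  by rewrite (scalable_linear l1) (scalable_linear l2).
by rewrite -bil_lift2// (counit_lift _ cM).
Qed.

(* The elements [m_(0) ⊗ h * m_(1)] span [M ⊗ H], as
   [m ⊗ h = m_(0)(0) ⊗ h * T m_(1) * m_(0)(1)]. *)
Lemma bilinear_coaction_ext (W : lmodType k) (F G : M -> H -> W) :
    bilinear_map F -> bilinear_map G ->
    (forall m h, \sw_(n, t <- rho m) F n (h * t)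
       = \sw_(n, t <- rho m) G n (h * t)) ->
  forall m h, F m h = G m h.
Proof.
have expand (E : M -> H -> W) m h : bilinear_map E ->
    E m h = \sw_(n, t <- rho m) \sw_(n', t' <- rho n) E n' (h * T t * t').
  move=> bE; rewrite (comodule_lift
    (F := fun n' t' t => E n' (h * T t * t')) m cM); last by lin.
  transitivity (\sw_(n, t <- rho m) E (eps t *: n) h).
    by rewrite -(bil_lift1 (B := E))// (counit_lift _ cM).
  apply: eq_lift => n t.
  under eq_lift => t1 t2 do rewrite -mulrA.
  rewrite -(bil_lift2 (B := fun y x => E y (h * x))); last by lin.
  rewrite (inv_antipodel_lift HH ST TS) -scalerAr mulr1.
  have l1 := bE.1 h; have l2 := bE.2 n.
  by rewrite (scalable_linear l1) (scalable_linear l2).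
move=> bF bG FG m h; rewrite (expand F)// (expand G)//.
by apply: eq_lift => n t; apply: FG.
Qed.

(** On the spanning elements the left side becomes [rho (dot (phi h) m)], which colinearity of [phi]
    expands. *)
Lemma coaction_average m h :
  rho (average m h) = \sw_(h1, h2 <- D h) average m h1 ⊗ₜ h2.
Proof.
move: m h; apply: bilinear_coaction_ext; [by lin | by lin |] => m h.
rewrite -app_lift average_coaction (coaction_dot hM) phi_colinear.
rewrite -/(\sw_(h1, h2 <- D h) phi h1 ⊗ₜ h2).
rewrite -/(\sw_(a, b <- \sw_(h1, h2 <- D h) phi h1 ⊗ₜ h2)
  \sw_(n, t <- rho m) dot a n ⊗ₜ (b * t)).
rewrite lift_lift; last by lin.
(* Both sides meet here: coassociativity and [average_coaction] at [h1] give the left side,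
   multiplicativity of [D] the right side. *)
transitivity (\sw_(h1, h2 <- D h) \sw_(n, t <- rho m) \sw_(t1, t2 <- D t)
  average n (h1 * t1) ⊗ₜ (h2 * t2)).
  apply: eq_lift => h1 h2; rewrite lift_tens; last by lin.
  rewrite -(comodule_lift
    (F := fun n t1 t2 => average n (h1 * t1) ⊗ₜ (h2 * t2)) m cM); last by lin.
  apply: eq_lift => n t.
  by rewrite -(bil_lift1 _ _ _ (tens_bilinear M H)) average_coaction.
rewrite lift_exchange; apply: eq_lift => n t.
by rewrite (comulM_lift HH (F := fun x y => average n x ⊗ₜ y)); last by lin.
Qed.

(** * Compatibility of averaging with the actions of [A] *)

Section Equivariance.
Hypothesis phi_swap : forall g h t, phi (g * h * t) = phi (h * g * t).

(** The factor [T u] sits at the right end of the argument of [phi], so the exchange of [g] and [h]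
    takes place in front of it; hence the third factor in [phi_swap]. *)
Lemma average_swap m g h t : average m (g * (h * t)) = average m (h * (g * t)).
Proof.
by apply: eq_lift => n u; congr (dot _ n); rewrite -!mulrA mulrA phi_swap mulrA.
Qed.

(** On the spanning elements the right side is [dot a (dot (phi h) m)]. Commuting the two actions
    and expanding by [average_coaction] at [dot a m] gives the left side with [h] and [a1] in the
    other order, which [average_swap] repairs. *)
Lemma average_dot a m h :
    (forall a h m, dot a (dot (phi h) m) = dot (phi h) (dot a m)) ->
  \sw_(a0, a1 <- rhoA a) average (dot a0 m) (a1 * h) = dot a (average m h).
Proof.
move=> dotC; move: m h.
apply: bilinear_coaction_ext; [by lin | by lin |] => m h.
rewrite -(bil_lift2 _ _ _ bdot) average_coaction.
rewrite dotC -average_coaction (coaction_dot hM) lift_exchange.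
rewrite -/(\sw_(a0, a1 <- rhoA a) \sw_(n, t <- rho m) dot a0 n ⊗ₜ (a1 * t)).
rewrite lift_lift; last by lin.
apply: eq_lift => a0 a1; rewrite lift_lift; last by lin.
apply: eq_lift => n t; rewrite lift_tens; last by lin.
exact: average_swap.
Qed.

Variables (br : A -> A -> A -> A) (dia : A -> A -> M -> M).
Hypothesis hdia : lie3_comodule D eps br rhoA dia rho.
Hypothesis dia_dot_phi : forall x y h m,
  dia x y (dot (phi h) m) = dot (phi h) (dia x y m).

Let tdia : trilinear_map dia := lie3_mod_trilinear (lie3_comod_lie3 hdia).

(** The argument of [average_dot], with [dia_dot_phi] commuting the two actions and [x1 * y1] in
    place of [a1]. *)
Lemma average_dia x y m h :
  \sw_(x0, x1 <- rhoA x) \sw_(y0, y1 <- rhoA y)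
    average (dia x0 y0 m) (x1 * y1 * h) = dia x y (average m h).
Proof.
have ldia : linear (dia x y) by case: tdia.
move: m h; apply: bilinear_coaction_ext; [by lin | by lin |] => m h.
rewrite -(linear_lift _ _ ldia) average_coaction.
rewrite dia_dot_phi -average_coaction (coaction_dia hdia) lift_exchange.
rewrite -/(\sw_(x0, x1 <- rhoA x) \sw_(y0, y1 <- rhoA y)
  \sw_(n, t <- rho m) dia x0 y0 n ⊗ₜ (x1 * y1 * t)).
rewrite lift_lift; last by lin.
apply: eq_lift => x0 x1; rewrite lift_exchange lift_lift; last by lin.
apply: eq_lift => y0 y1; rewrite lift_lift; last by lin.
apply: eq_lift => n t; rewrite lift_tens; last by lin.
exact: average_swap.
Qed.

End Equivariance.

(** * Averaging a linear map [g0 : V -> M] *)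

Section Extension.
Variables (V : lmodType k) (rhoV : {linear V -> V ⊗ H}).
Hypothesis cV : comodule D eps rhoV.
Variable g0 : {linear V -> M}.

Definition average_map (v : V) : M := \sw_(w, t <- rhoV v) average (g0 w) t.

Lemma average_map_linear : linear average_map.
Proof. by rewrite /average_map; lin. Qed.

Definition average_linmap : {linear V -> M} :=
  HB.pack average_map (GRing.isLinear.Build k V M *:%R average_map average_map_linear).

(** [coaction_average] moves the coaction to the [H] factor, where coassociativity of [rhoV]
    applies; [g0] itself need only be linear. *)
Lemma average_linmap_colinear : colinear rhoV rho average_linmap.
Proof.
move=> v; rewrite -/(\sw_(w, t <- rhoV v) average_map w ⊗ₜ t).
rewrite -[average_linmap v]/(average_map v) {1}/average_map app_lift.
under eq_lift => w t do rewrite coaction_average.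
rewrite -(comodule_lift (F := fun w t1 t2 => average (g0 w) t1 ⊗ₜ t2) v cV);
  last by lin.
apply: eq_lift => w t.
by rewrite -(bil_lift1 (B := fun x y => x ⊗ₜ y))//; exact: tens_bilinear.
Qed.

(** As [i] and [f] are colinear and [g0] extends [f], the average at [i u] is that of the coaction
    of [f u], which is [dot (phi 1) (f u)] by [average_coaction]. *)
Lemma average_linmap_extends (U : lmodType k) (rhoU : {linear U -> U ⊗ H})
    (i : {linear U -> V}) (f : {linear U -> M}) :
    colinear rhoU rhoV i -> colinear rhoU rho f ->
    phi 1 = one -> (forall u, g0 (i u) = f u) ->
  forall u, average_linmap (i u) = f u.
Proof.
move=> ci cf phi1 g0i u; have <- := alg_mod1 (hopf_mod_alg hM) (f u).
rewrite -phi1 -average_coaction cf -[LHS]/(average_map _) /average_map ci.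
rewrite -/(\sw_(w, t <- rhoU u) i w ⊗ₜ t) -/(\sw_(w, t <- rhoU u) f w ⊗ₜ t).
rewrite !lift_lift; [|by lin|by lin].
apply: eq_lift => w t; rewrite !lift_tens; [|by lin|by lin].
by rewrite g0i mul1r.
Qed.

Hypothesis phi_swap : forall g h t, phi (g * h * t) = phi (h * g * t).

(** The coaction of [diaV x y v] contributes the factors [x1 * y1], which [average_dia] absorbs once
    [g0] has been moved past the action. *)
Lemma average_linmap_lie3_linear (br : A -> A -> A -> A)
    (dia : A -> A -> M -> M) (diaV : A -> A -> V -> V) :
    lie3_comodule D eps br rhoA dia rho -> lie3_comodule D eps br rhoA diaV rhoV ->
    (forall x y h m, dia x y (dot (phi h) m) = dot (phi h) (dia x y m)) ->
    lie3_linear diaV dia g0 ->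
  lie3_linear diaV dia average_linmap.
Proof.
move=> hdia hV dia_dot_phi g0dia x y v.
have tdia : trilinear_map dia := lie3_mod_trilinear (lie3_comod_lie3 hdia).
have ldia : linear (dia x y) by case: tdia.
rewrite -[LHS]/(average_map _) -[RHS]/(dia x y (average_map _)) /average_map.
rewrite (linear_lift _ _ ldia).
under [RHS]eq_lift => w t do rewrite -(average_dia phi_swap hdia dia_dot_phi).
rewrite (coaction_dia hV) [RHS]lift_exchange.
rewrite -/(\sw_(x0, x1 <- rhoA x) \sw_(y0, y1 <- rhoA y)
  \sw_(w, t <- rhoV v) diaV x0 y0 w ⊗ₜ (x1 * y1 * t)).
rewrite lift_lift; last by lin.
apply: eq_lift => x0 x1; rewrite [RHS]lift_exchange lift_lift; last by lin.
apply: eq_lift => y0 y1; rewrite lift_lift; last by lin.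
by apply: eq_lift => w t; rewrite lift_tens ?g0dia; last by lin.
Qed.

Lemma average_linmap_alg_linear (dotV : A -> V -> V) :
    hopf_module D eps mul one rhoA dotV rhoV -> alg_linear dotV dot g0 ->
    (forall a h m, dot a (dot (phi h) m) = dot (phi h) (dot a m)) ->
  alg_linear dotV dot average_linmap.
Proof.
move=> hV g0dot dotC a v.
rewrite -[LHS]/(average_map _) -[RHS]/(dot a (average_map _)) /average_map.
rewrite (bil_lift2 _ _ _ bdot).
under [RHS]eq_lift => w t do rewrite -(average_dot phi_swap _ _ _ dotC).
rewrite (coaction_dot hV) [RHS]lift_exchange.
rewrite -/(\sw_(a0, a1 <- rhoA a) \sw_(w, t <- rhoV v) dotV a0 w ⊗ₜ (a1 * t)).
rewrite lift_lift; last by lin.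
apply: eq_lift => a0 a1; rewrite lift_lift; last by lin.
by apply: eq_lift => w t; rewrite lift_tens ?g0dot; last by lin.
Qed.
End Extension.
End Averaging.

(** * Transfer of injectivity *)

Theorem theorem2p10 (k : fieldType) (char0 : [pchar k] =i pred0)
  (H : algType k) (D : {linear H -> H ⊗ H}) (eps : {linear H -> k^o})
  (S : {linear H -> H}) (HH : hopf_algebra D eps S) (S_bij : bijective S)
  (A : lmodType k) (mul : A -> A -> A) (one : A) (br : A -> A -> A -> A)
  (rhoA : {linear A -> A ⊗ H})
  (HA : comodule_poisson3_algebra D eps mul one br rhoA)
  (phi : {linear H -> A}) (phi_center : forall h, lie3_center br (phi h))
  (phi_colinear : colinear D rhoA phi) (phi1 : phi 1 = one) :
  ((forall g h : H, g * h = h * g) \/ alg_map mul one phi ->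
   forall (M : lmodType k) (dot : A -> M -> M) (dia : A -> A -> M -> M)
     (rho : {linear M -> M ⊗ H}),
   poisson3_hopf_module D eps mul one br rhoA dot dia rho ->
   injective_lie3_module br dia ->
   injective_lie3_comodule D eps br rhoA dia rho)
  /\
  ((forall g h : H, g * h = h * g) ->
   forall (M : lmodType k) (dot : A -> M -> M) (dia : A -> A -> M -> M)
     (rho : {linear M -> M ⊗ H}),
   poisson3_hopf_module D eps mul one br rhoA dot dia rho ->
   injective_poisson3_module mul one br dot dia ->
   injective_poisson3_hopf_module D eps mul one br rhoA dot dia rho).
Proof.
have [Sinv ST TS] := S_bij.
have lT : linear Sinv by exact: can2_linear ST TS.
pose T : {linear H -> H} := HB.pack Sinv (GRing.isLinear.Build k H H *:%R Sinv lT).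
have {}ST : cancel S T := ST.
have {}TS : cancel T S := TS.
have [[_ _ mulC _] hbr _] := comod_poisson3 HA.
(* Centrality is given in the first slot of the bracket; two transpositions carry it to the
   third. *)
have br_phi x y h : br x y (phi h) = 0.
  by rewrite (lie3_skew23 hbr) (lie3_skew12 hbr) phi_center !oppr0.
(* In the Leibniz rule for [dia x y] on [dot (phi h) m] the bracket term vanishes. *)
have dia_dot_phi (M : lmodType k) (dot : A -> M -> M) dia x y h m :
    poisson3_module mul one br dot dia ->
    dia x y (dot (phi h) m) = dot (phi h) (dia x y m).
  move=> hM; rewrite (poisson3_modr hM) br_phi.
  have ldot := (alg_mod_bilinear (poisson3_mod_alg hM)).1 m.
  by have := scalable_linear ldot 0 0; rewrite /= !scale0r => ->; rewrite add0r.
split=> [H_or M dot dia rho hM M_inj | HC M dot dia rho hM M_inj].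
  (* The only place where the two alternatives differ: either [H] is commutative, or [phi] carries
     products into the commutative algebra [A]. *)
  have phi_swap g h t : phi (g * h * t) = phi (h * g * t).
    case: H_or => [HC | [_ phiM]]; first by rewrite (HC g).
    by rewrite !phiM (mulC (phi g)).
  have [hP hH hL] := hM.
  move=> U V diaU rhoU diaV rhoV hU hV i f il ic ii fl fc.
  (* This extension ignores the coactions; averaging makes it colinear without changing its values
     on the image of [i]. *)
  have [g0 [g0l g0i]] :=
    M_inj U V diaU diaV (lie3_comod_lie3 hU) (lie3_comod_lie3 hV) i f il ii fl.
  have cV := lie3_comod_comod hV.
  exists (average_linmap T phi hH rhoV g0); split.
  - by apply: (average_linmap_lie3_linear HH ST TS hH phi_swap hL hV)
      => // *; exact: dia_dot_phi hP.
  - exact: (average_linmap_colinear HH ST TS phi_colinear hH cV g0).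
  - exact: (average_linmap_extends HH ST TS hH ic fc phi1 g0i).
have phi_swap g h t : phi (g * h * t) = phi (h * g * t) by rewrite (HC g).
have [hP hH hL] := hM.
move=> U V dotU diaU rhoU dotV diaV rhoV hU hV i f ia il ic ii fa fl fc.
have [hPU _ _] := hU; have [hPV hHV hLV] := hV.
have [g0 [g0a g0l g0i]] :=
  M_inj U V dotU diaU dotV diaV hPU hPV i f ia il ii fa fl.
have cV := lie3_comod_comod hLV.
exists (average_linmap T phi hH rhoV g0); split.
- apply: (average_linmap_alg_linear HH ST TS hH phi_swap hHV) => //.
  (* The actions of [a] and [phi h] commute because [A] is commutative. *)
  move=> a h m; have dotM := alg_modM (hopf_mod_alg hH).
  by rewrite -!dotM mulC.
- by apply: (average_linmap_lie3_linear HH ST TS hH phi_swap hL hLV)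
    => // *; exact: dia_dot_phi hP.
- exact: (average_linmap_colinear HH ST TS phi_colinear hH cV g0).
- exact: (average_linmap_extends HH ST TS hH ic fc phi1 g0i).
Qed.
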